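(* Let $X=\{a_1,\dots,a_\ell\}$ be a finite set of $\ell$ distinct points, let $N\ge 2$ and $k\in\{2,\ldots,N\}$. Let $(x_1,\dots,x_N)\in X^N$, let $\mu_k:=M_kS_N\delta_{(x_1,\dots,x_N)}$ and let $\lambda:=M_1\mu_k=\frac1N\sum_{i=1}^N\delta_{x_i}$ be its one-point marginal. (The measures $\mu_k$ of this form are exactly the extremal $N$-representable $k$-plans.) Then $$\mu_k=\frac{N^{k-1}}{\prod_{i=1}^{k-1}(N-i)}\left[\lambda^{\otimes k}+\sum_{j=1}^{k-1}\frac{(-1)^j}{N^j}S_kP_j^{(k)}(\lambda)\right]=:F_{N,k}(\lambda),$$ where for $j=1,\dots,k-1$ $$P_j^{(k)}(\lambda)=\sum_{\substack{\mathbf p=(p_1,\dots,p_{n(\mathbf p)})\ \text{partition of } j\\ \text{with } j+n(\mathbf p)\le k}} d^{(k)}_{\mathbf p}\ \mathrm{id}^{\otimes(p_1+1)}_\#\lambda\otimes\cdots\otimes\mathrm{id}^{\otimes(p_{n(\mathbf p)}+1)}_\#\lambda\otimes\lambda^{\otimes(k-j-n(\mathbf p))}$$ with positive coefficients $$d^{(k)}_{\mathbf p}=\frac{k!}{(k-j-n(\mathbf p))!}\ \prod_{i=1}^{n(\mathbf p)}\frac1{p_i+1}\ \prod_{q\in\mathrm{Ran}\,\mathbf p}\frac1{(|\mathbf p^{-1}(q)|)!}.$$ Moreover, for $j=1,\dots,k-1$ the coefficients satisfy the sum rule $$\sum_{\substack{\mathbf p\ \text{partition of } j\\ \text{with } j+n(\mathbf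 p)\le k}} d^{(k)}_{\mathbf p}=\sum_{1\le i_1<\dots<i_j\le k-1} i_1\cdot\ldots\cdot i_j=:c_j^{(k)}.$$ In particular, $\|P_j^{(k)}(\lambda)\|_{\mathrm{TV}}=\int_{X^k}dP_j^{(k)}(\lambda)=c_j^{(k)}$.
   Context: $\mathcal P(Y)$ denotes the set of Borel probability measures on $Y$. For $\gamma\in\mathcal P(X^N)$ and a permutation $\sigma$ of $\{1,\dots,N\}$, $\gamma^\sigma$ is defined by $\int\varphi\,d\gamma^\sigma=\int\varphi(x_{\sigma(1)},\dots,x_{\sigma(N)})\,d\gamma(x_1,\dots,x_N)$; the symmetrization is $S_N\gamma=\frac1{N!}\sum_\sigma\gamma^\sigma$. The operator $S_k$ is defined in the same way on $X^k$ and extended linearly to finite signed measures. $M_k\gamma$ is the $k$-point marginal, $(M_k\gamma)(A)=\gamma(A\times X^{N-k})$ (with $M_N\gamma=\gamma$). A $k$-plan (probability measure on $X^k$) is $N$-representable if it equals $M_k\gamma$ for some symmetric $\gamma\in\mathcal P(X^N)$ (i.e. $S_N\gamma=\gamma$). $\lambda^{\otimes m}$ is the $m$-fold product measure (factor omitted if $m=0$), and $\mathrm{id}^{\otimes m}_\#\lambda$ is the push-forward of $\lambda$ under $x\mapsto(x,\dots,x)\in X^m$. A partition of $j\in\mathbb N=\{1,2,\dots\}$ of length $n$ is a vector $\mathbf p=(p_1,\dots,p_n)\in\mathbb N^n$ with $p_1\ge\dots\ge p_n$ and $\sum_ip_i=j$; $n(\mathbf p)$ is its length, $\mathrm{Ran}\,\mathbf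 p$ the set of values taken by its components, and $|\mathbf p^{-1}(q)|$ the number of components equal to $q$. For signed measures, $\|\mu-\nu\|_{\mathrm{TV}}=\sup_A|\mu(A)-\nu(A)|$, the supremum being over Borel sets $A$. *)

(* Defs.v *)
From HB Require Import structures.
From mathcomp Require Import all_boot all_order all_algebra perm.
From mathcomp Require Import classical_sets reals.

Set Implicit Arguments.
Unset Strict Implicit.
Unset Printing Implicit Defensive.

Import Order.TTheory GRing.Theory Num.Theory.

Local Open Scope ring_scope.

(* A finite signed measure on a finite (discrete) set T is encoded by its mass
   function x |-> mu {x}; [mass] recovers the set function on the Borel sets of
   T, which are all the subsets of T.  The pointwise operations of the
   R-module {ffun T -> R^o} are the linear operations on signed measures. *)
Notation smeasure R T := {ffun T -> R^o}.

Section Measures.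
Context {R : realType}.

Definition mass {T : finType} (mu : smeasure R T) (A : {set T}) : R :=
  \sum_(x in A) mu x.

Definition is_probability {T : finType} (mu : smeasure R T) : Prop :=
  (forall A : {set T}, 0 <= mass mu A) /\ mass mu [set: T]%SET = 1.

Definition dirac {T : finType} (a : T) : smeasure R T :=
  [ffun x => (x == a)%:R].

Definition pushforward {T U : finType} (f : T -> U) (mu : smeasure R T) :
    smeasure R U :=
  [ffun y => mass mu (f @^-1: [set y])%SET].

Definition prod_measure {T U : finType} (mu : smeasure R T)
    (nu : smeasure R U) : smeasure R (T * U)%type :=
  [ffun z => mu z.1 * nu z.2].

Definition tv_dist {T : finType} (mu nu : smeasure R T) : R :=
  sup [set `|mass mu A - mass nu A| | A in [set: {set T}]]%classic.

Definition tv_norm {T : finType} (mu : smeasure R T) : R := tv_dist mu 0.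

Definition extreme_point {V : lmodType R} (C : V -> Prop) (v : V) : Prop :=
  C v /\ forall (v1 v2 : V) (t : R), C v1 -> C v2 -> 0 < t < 1 ->
    v = t *: v1 + (1 - t) *: v2 -> v1 = v /\ v2 = v.

Lemma mass_pushforward (T U : finType) (f : T -> U) (mu : smeasure R T)
    (A : {set U}) :
  mass (pushforward f mu) A = mass mu (f @^-1: A)%SET.
Proof.
rewrite /mass [RHS](partition_big f (mem A)) /=; last by move=> x; rewrite inE.
apply: eq_bigr => y yA; rewrite ffunE; apply: eq_bigl => x.
by rewrite !inE; case: eqP => [->|_]; rewrite ?yA ?andbT ?andbF.
Qed.

End Measures.

Section Plans.
Context {R : realType} {X : finType}.

Definition permute {n : nat} (s : 'S_n) (g : smeasure R (n.-tuple X)) :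
    smeasure R (n.-tuple X) :=
  pushforward (fun x : n.-tuple X => [tuple tnth x (s i) | i < n]) g.

Definition symmetrize {n : nat} (g : smeasure R (n.-tuple X)) :
    smeasure R (n.-tuple X) :=
  (n`!%:R)^-1 *: \sum_(s : 'S_n) permute s g.

(* For k <= n the set below is {t} x X^(n - k). *)
Definition marginal {n : nat} (k : nat) (g : smeasure R (n.-tuple X)) :
    smeasure R (k.-tuple X) :=
  [ffun t : k.-tuple X =>
     mass g [set u : n.-tuple X | take k u == t :> seq X]%SET].

(* The one-point marginal, with X^1 identified with X. *)
Definition marginal1 {n : nat} (g : smeasure R (n.-tuple X)) : smeasure R X :=
  pushforward (fun t : 1.-tuple X => thead t) (marginal 1 g).

Definition representable (N k : nat) (mu : smeasure R (k.-tuple X)) : Prop :=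
  is_probability mu /\
  exists g : smeasure R (N.-tuple X),
    [/\ is_probability g, symmetrize g = g & mu = marginal k g].

Definition power (lam : smeasure R X) (m : nat) : smeasure R (m.-tuple X) :=
  [ffun t : m.-tuple X => \prod_(i < m) lam (tnth t i)].

Definition diagonal (lam : smeasure R X) (m : nat) : smeasure R (m.-tuple X) :=
  pushforward (fun x : X => nseq_tuple m x) lam.

Definition tensor {m n : nat} (mu : smeasure R (m.-tuple X))
    (nu : smeasure R (n.-tuple X)) : smeasure R ((m + n).-tuple X) :=
  pushforward (fun z : m.-tuple X * n.-tuple X => cat_tuple z.1 z.2)
    (prod_measure mu nu).

(* Transport along a (propositional) equality m = k: a measure on X^m is read
   as a measure on X^k.  It is only ever used for m = k (see [arityE]). *)
Definition retype {m : nat} (k : nat) (mu : smeasure R (m.-tuple X)) :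
    smeasure R (k.-tuple X) :=
  [ffun t : k.-tuple X => \sum_(u : m.-tuple X | u == t :> seq X) mu u].

Lemma retypeE (m k : nat) (e : m = k) (mu : smeasure R (m.-tuple X))
    (t : m.-tuple X) :
  retype k mu (tcast e t) = mu t.
Proof.
by case: k / e; rewrite ffunE tcast_id (big_pred1 t).
Qed.

End Plans.

Definition is_partition (j : nat) (p : seq nat) : bool :=
  [&& sorted geq p, all (fun q => 0 < q)%N p & sumn p == j].

Definition partitions (j : nat) : seq (seq nat) :=
  [seq p <- [seq map val (b : seq 'I_j.+1) | b : {bseq j of 'I_j.+1}]
   | is_partition j p].

Lemma partitions_uniq (j : nat) : uniq (partitions j).
Proof.
apply: filter_uniq; rewrite map_inj_uniq ?enum_uniq // => b c.
by move/(inj_map val_inj)/val_inj.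
Qed.

Lemma mem_partitions (j : nat) (p : seq nat) :
  (p \in partitions j) = is_partition j p.
Proof.
rewrite mem_filter; case: (boolP (is_partition j p)) => //= /and3P[_ p_gt0 /eqP pj].
have le_size : (size p <= j)%N.
  rewrite -pj; elim: p p_gt0 {pj} => //= q p IH /andP[q_gt0 /IH].
  by move=> h; rewrite -add1n leq_add.
have le_j : all (fun q => q < j.+1)%N p.
  apply/allP => q qp; rewrite ltnS -pj sumnE.
  by rewrite (big_rem q qp) /= leq_addr.
have sz : (size [seq inord q : 'I_j.+1 | q <- p] <= j)%N by rewrite size_map.
apply/mapP; exists (Bseq sz); first by rewrite mem_enum.
rewrite /= -map_comp -[LHS]map_id; apply/eq_in_map => q qp /=.
by rewrite inordK // (allP le_j).
Qed.

Section Polynomials.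
Context {R : realType} {X : finType}.

(* (p_1 + 1) + ... + (p_n + 1) + r *)
Fixpoint arity (p : seq nat) (r : nat) : nat :=
  if p is q :: p' then (q.+1 + arity p' r)%N else r.

Lemma arityE (p : seq nat) (r : nat) :
  arity p r = (sumn p + size p + r)%N.
Proof. by elim: p => //= q p ->; rewrite addnS !addSn !addnA. Qed.

Fixpoint block_product (lam : smeasure R X) (p : seq nat) (r : nat) :
    smeasure R ((arity p r).-tuple X) :=
  if p is q :: p' then tensor (diagonal lam q.+1) (block_product lam p' r)
  else power lam r.

Definition dcoef (k : nat) (p : seq nat) : R :=
  k`!%:R / ((k - sumn p - size p)`!)%:R
  * \prod_(q <- p) (q.+1%:R)^-1
  * \prod_(q <- undup p) ((count_mem q p)`!%:R)^-1.

Definition Ppoly (k j : nat) (lam : smeasure R X) : smeasure R (k.-tuple X) :=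
  \sum_(p <- partitions j | (j + size p <= k)%N)
    dcoef k p *: retype k (block_product lam p (k - j - size p)).

Definition Fmap (N k : nat) (lam : smeasure R X) : smeasure R (k.-tuple X) :=
  (N%:R ^+ k.-1 / \prod_(1 <= i < k) (N%:R - i%:R)) *:
    (power lam k
     + \sum_(1 <= j < k) ((-1) ^+ j / N%:R ^+ j) *: symmetrize (Ppoly k j lam)).

End Polynomials.

(* The tuples t = (i_1, ..., i_j) with 0 < i_1 < ... < i_j < k. *)
Definition ccoef (k j : nat) : nat :=
  \sum_(t : j.-tuple 'I_k | path ltn 0%N [seq val i | i <- t])
    \prod_(i <- t) (i : nat).

(* Main.v *)
(* The moment of a measure on X^k is the polynomial obtained by integrating
   t |-> Y_(t_1) * ... * Y_(t_k) with one indeterminate per point of X; it turns tensor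
   products into products and determines the measure up to symmetrization.  The moment of
   M_k S_N delta_x is, up to the factor k! (N - k)! / N!, the elementary symmetric
   polynomial e_k of the Y_(x_i), while that of id^(m)_# lambda is the power sum p_m divided
   by N.  So the formula for mu_k is the expansion of e_k in power sums: k! e_k is the sum over
   the permutations of k letters of the product of (-1)^(m-1) p_m over the cycle lengths m.
   There d_p counts the permutations whose nontrivial cycles have the lengths p_i + 1, and
   both sides obey Newton's recursion.  Giving a cycle of length m the weight t^(m-1)
   instead yields prod_(i < k) (1 + i t), hence the sum rule.
   Each mu_k is extreme because, for symmetric gamma, the mean square deviation of the number
   of coordinates equal to a given point from its value at x depends linearly on M_2 gamma,
   is nonnegative, and vanishes for all points only if gamma = S_N delta_x. *)
Require Import Defs.
From mathcomp Require Import all_boot all_order all_algebra perm.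
From mathcomp Require Import reals.
From mathcomp Require Import zify ring.
From mathcomp Require Import mpoly.

Set Implicit Arguments.
Unset Strict Implicit.
Unset Printing Implicit Defensive.

Import Order.TTheory GRing.Theory Num.Theory.

Local Open Scope ring_scope.

(** * Sums over partitions and the cycle index *)

(** These are the cycle types of permutations of [k] letters: a part [q] stands for a cycle of
    length [q + 1], and the remaining [k - sumn p - size p] letters are fixed. *)
Definition bounded_partitions (k : nat) : seq (seq nat) :=
  [seq p <- flatten [seq partitions j | j <- iota 0 k.+1]
   | (sumn p + size p <= k)%N].

Lemma mem_bounded_partitions (k : nat) (p : seq nat) :
  (p \in bounded_partitions k) =
  [&& sorted geq p, all (fun q => 0 < q)%N p & (sumn p + size p <= k)%N].
Proof.
rewrite mem_filter andbC andbA; case: leqP => [le_k|_]; last by rewrite !andbF.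
rewrite !andbT; apply/flatten_mapP/andP => [[j _]|[ps p0]].
  by rewrite mem_partitions => /and3P[].
exists (sumn p); last by rewrite mem_partitions /is_partition ps p0 eqxx.
by rewrite mem_iota add0n ltnS (leq_trans _ le_k) // leq_addr.
Qed.

Lemma bounded_partitions_uniq (k : nat) : uniq (bounded_partitions k).
Proof.
apply/filter_uniq; elim: (iota 0 k.+1) (iota_uniq 0 k.+1) => //= j s IHs.
case/andP=> js us; rewrite cat_uniq partitions_uniq IHs // andbT.
apply/hasPn => p /flatten_mapP[i si]; rewrite mem_partitions => /and3P[_ _ /eqP pi].
apply: contra js => /=; rewrite mem_partitions => /and3P[_ _ /eqP <-].
by rewrite pi.
Qed.

Lemma sum_bounded_partitions (V : nmodType) (k : nat) (F : seq nat -> V) :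
  \sum_(p <- bounded_partitions k) F p =
  \sum_(0 <= j < k.+1) \sum_(p <- partitions j | (j + size p <= k)%N) F p.
Proof.
rewrite big_filter big_flatten big_map /index_iota subn0.
apply: eq_bigr => j _; rewrite big_seq_cond [RHS]big_seq_cond.
apply: eq_bigl => p; case: (boolP (p \in partitions j)) => //.
by rewrite mem_partitions => /and3P[_ _ /eqP ->].
Qed.

Lemma partitions0 : perm_eq (partitions 0) [:: [::]].
Proof.
apply: uniq_perm; rewrite ?partitions_uniq // => p.
rewrite mem_partitions inE /is_partition; case: p => //= q p.
by case: q => [|q]; rewrite ?andbF //= addSn andbF.
Qed.

(** This matches the range of [j] in [Fmap]: [j = 0] leaves only the empty partition, and [j = k]
    leaves nothing, since a nonempty partition has [size p >= 1]. *)
Lemma sum_bounded_partitions_gt0 (V : nmodType) (k : nat) (F : seq nat -> V) :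
  (0 < k)%N ->
  \sum_(p <- bounded_partitions k) F p = F [::] +
  \sum_(1 <= j < k) \sum_(p <- partitions j | (j + size p <= k)%N) F p.
Proof.
move=> k0; rewrite sum_bounded_partitions big_ltn //; congr (_ + _).
  by rewrite (perm_big _ partitions0) big_cons big_nil /= addr0.
rewrite big_nat_recr //= [X in _ + X]big_seq_cond [X in _ + X]big1 ?addr0 //.
move=> p /andP[]; rewrite mem_partitions => /and3P[_ _ /eqP pk].
case: p pk => [/= pk|q p _ /=]; first by rewrite -pk in k0.
by rewrite addnS ltnNge leq_addr.
Qed.

Lemma sumn_size_count (p : seq nat) :
  (sumn p + size p = \sum_(m <- undup p) m.+1 * count_mem m p)%N.
Proof.
have -> : (sumn p + size p = \sum_(m <- p) m.+1)%N.
  by elim: p => [|m p IH]; rewrite ?big_nil //= big_cons -IH; lia.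
rewrite -big_undup_iterop_count /=; apply: eq_bigr => m _.
by rewrite Monoid.iteropE iter_addn_0.
Qed.

Section CycleIndex.
Context {R : realType} {A : comAlgType R}.
Implicit Types (w : nat -> A) (p : seq nat).

(** The proportion of permutations of [k] letters that have cycle type [p], when [p] fits into [k]
    letters. *)
Definition cweight (k : nat) p : R :=
  ((k - sumn p - size p)`!%:R)^-1 * \prod_(q <- p) (q.+1%:R)^-1
  * \prod_(q <- undup p) ((count_mem q p)`!%:R)^-1.

Lemma dcoefE (k : nat) p : dcoef k p = k`!%:R * cweight k p.
Proof. by rewrite /dcoef /cweight !mulrA. Qed.

(** Absent parts contribute [0! = 1], so two partitions can be compared over a common index set. *)
Lemma prod_count_fact_subset p (s : seq nat) : uniq s -> {subset p <= s} ->
  \prod_(q <- undup p) ((count_mem q p)`!%:R)^-1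
  = \prod_(q <- s) ((count_mem q p)`!%:R)^-1 :> R.
Proof.
move=> us ps; rewrite [RHS](bigID (mem p)) /= [X in _ = _ * X]big1 ?mulr1.
  rewrite -[RHS]big_filter; apply/perm_big/uniq_perm; rewrite ?filter_uniq ?undup_uniq //.
  by move=> q; rewrite mem_undup mem_filter; case: (boolP (q \in p)) => //= /ps.
by move=> q /count_memPn ->; rewrite fact0 invr1.
Qed.

(** Deleting one part [m] removes one factor [1 / (m + 1)] and lowers the multiplicity of [m] by
    one; the natural number on the left cancels both effects. *)
Lemma cweight_cons (k m : nat) p p' : perm_eq p (m :: p') ->
  (m.+1 * count_mem m p)%:R * cweight k p = cweight (k - m.+1) p'.
Proof.
move=> pm; rewrite /cweight (perm_sumn pm) (perm_size pm) /=.
have -> : (k - (m + sumn p') - (size p').+1 = k - m.+1 - sumn p' - size p')%N by lia.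
rewrite (perm_big _ pm) big_cons.
rewrite (@prod_count_fact_subset p' (undup (m :: p'))) ?undup_uniq //; last first.
  by move=> q qp; rewrite mem_undup inE qp orbT.
rewrite (@prod_count_fact_subset p (undup (m :: p'))) ?undup_uniq //; last first.
  by move=> q; rewrite (perm_mem pm) mem_undup.
have mm : m \in undup (m :: p') by rewrite mem_undup mem_head.
rewrite !(bigD1_seq m mm) ?undup_uniq //=.
have -> : \prod_(i <- undup (m :: p') | i != m) ((count_mem i p)`!%:R)^-1
   = \prod_(i <- undup (m :: p') | i != m) ((count_mem i p')`!%:R)^-1 :> R.
  apply: eq_bigr => i im; move/seq.permP: pm => ->/=; rewrite eq_sym (negPf im).
  by rewrite add0n.
move/seq.permP: (pm) => ->/=; rewrite eqxx add1n factS !natrM.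
by field; rewrite !nat1r !pnatr_eq0 -!lt0n !fact_gt0.
Qed.

(** The cycle index of the symmetric group on [k] letters, with weight [w m] for a cycle of length
    [m]; the power of [w 1] accounts for the fixed letters. *)
Definition cycle_index w (k : nat) : A :=
  \sum_(p <- bounded_partitions k)
    cweight k p *: (\prod_(q <- p) w q.+1 * w 1%N ^+ (k - sumn p - size p)).

Lemma cycle_index0 w : cycle_index w 0 = 1.
Proof.
rewrite /cycle_index sum_bounded_partitions big_nat1 (perm_big _ partitions0).
rewrite big_cons big_nil /= big_nil mul1r addr0 /cweight !big_nil !mulr1.
by rewrite invr1 scale1r.
Qed.

(* Removing one part [m] from [p], i.e. deleting a cycle of length [m + 1]. *)
Lemma remove_part_perm (k : nat) :
  perm_eq [seq (m, rem m p) | p <- bounded_partitions k.+1, m <- undup p]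
          [seq (m, p) | m <- iota 1 k, p <- bounded_partitions (k - m)].
Proof.
have geqT : transitive geq by move=> a b c ab bc; apply: leq_trans bc ab.
have geqA : antisymmetric geq by move=> a b; rewrite andbC -eqn_leq => /eqP.
have geqt : total geq by move=> a b; apply: leq_total.
apply: uniq_perm.
(* A sorted sequence is determined by its multiset of entries, so [m] and [rem m p] determine
   [p]. *)
- apply: allpairs_uniq_dep => [|p _|]; rewrite ?bounded_partitions_uniq ?undup_uniq //.
  move=> _ _ /allpairsPdep[p [m [pP mp ->]]] /allpairsPdep[p' [m' [pP' mp' ->]]] /=.
  case=> mm; rewrite -{}mm in mp' *; rewrite !mem_undup in mp mp' => pp.
  suff -> : p = p' by [].
  move: pP pP'; rewrite !mem_bounded_partitions => /andP[ps _] /andP[ps' _].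
  apply: (sorted_eq geqT geqA) => //.
  by rewrite (permPl (perm_to_rem mp)) pp perm_sym perm_to_rem.
- apply: allpairs_uniq_dep => [|m _|]; rewrite ?iota_uniq ?bounded_partitions_uniq //.
  by move=> [m p] [m' p'] /= _ _ [-> ->].
case=> m p; apply/allpairsPdep/allpairsPdep => [[q [m' [qP]]]|[m' [q [m'P qP]]]].
  rewrite mem_undup => mq [? ?]; subst m' p; exists m, (rem m q).
  move: qP; rewrite !mem_bounded_partitions => /and3P[qs q0 qk].
  move: (allP q0 _ mq) qk; rewrite (perm_sumn (perm_to_rem mq)).
  rewrite (perm_size (perm_to_rem mq)) /= => m0 qk; split=> //.
    by rewrite mem_iota; lia.
  rewrite (subseq_sorted geqT (rem_subseq _ _) qs) /=.
  have -> : all (fun i => 0 < i)%N (rem m q) by apply/allP => i /mem_rem; apply: (allP q0).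
  by lia.
(* The inverse operation inserts [m] and sorts again. *)
case=> ? ?; subst m' q; exists (sort geq (m :: p)), m.
have pm : perm_eq (sort geq (m :: p)) (m :: p) by rewrite perm_sort.
move: qP m'P; rewrite !mem_bounded_partitions mem_iota => /and3P[ps p0 pk] /andP[m0 mk].
rewrite (perm_sumn pm) (perm_size pm) (perm_all _ pm) /= sort_sorted // m0 p0.
rewrite mem_undup mem_sort mem_head; split=> //; first by lia.
congr (_, _); apply: (sorted_eq geqT geqA) => //.
  by rewrite (subseq_sorted geqT (rem_subseq _ _)) // sort_sorted.
by rewrite -(perm_cons m) -(permPr (perm_to_rem _)) ?mem_sort ?mem_head // perm_sym.
Qed.

(** Newton's recursion. The factor [k.+1] counts the letters of a permutation; the fixed ones give
    the summand [m = 0], and those in cycles of length [m + 1] give the summand [m >= 1], with the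
    cycle removed. *)
Lemma cycle_indexS w (k : nat) :
  k.+1%:R *: cycle_index w k.+1 =
  \sum_(m < k.+1) w m.+1 * cycle_index w (k - m).
Proof.
pose mon K p := \prod_(q <- p) w q.+1 * w 1%N ^+ (K - sumn p - size p).
have monS K m p p' : perm_eq p (m :: p') ->
    mon K p = w m.+1 * mon (K - m.+1)%N p'.
  move=> pm; rewrite /mon (perm_sumn pm) (perm_size pm) (perm_big _ pm) big_cons /=.
  rewrite mulrA; congr (_ * _ ^+ _); lia.
have split_degree p : p \in bounded_partitions k.+1 ->
    k.+1%:R *: (cweight k.+1 p *: mon k.+1 p) =
    (k.+1 - sumn p - size p)%:R *: (cweight k.+1 p *: mon k.+1 p) +
    \sum_(m <- undup p) cweight (k - m) (rem m p) *: (w m.+1 * mon (k - m)%N (rem m p)).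
  rewrite mem_bounded_partitions => /and3P[ps p0 pk].
  have -> : \sum_(m <- undup p) cweight (k - m) (rem m p) *:
                (w m.+1 * mon (k - m)%N (rem m p)) =
      \sum_(m <- undup p) (m.+1 * count_mem m p)%:R *: (cweight k.+1 p *: mon k.+1 p).
    apply: eq_big_seq => m; rewrite mem_undup => mp; have pm := perm_to_rem mp.
    by rewrite scalerA (cweight_cons _ pm) (monS _ _ _ _ pm) !subSS.
  rewrite -scaler_suml -natr_sum -sumn_size_count -scalerDl -natrD.
  by congr (_%:R *: _); lia.
rewrite /cycle_index scaler_sumr (eq_big_seq _ split_degree) big_split /=.
rewrite big_ord_recl /= subn0; congr (_ + _).
  (* Cycle types without a fixed letter vanish here; the others are cycle types on [k] letters with
     one fixed letter added. *)
  rewrite (bigID (fun p => sumn p + size p <= k)%N) /= [X in _ + X]big1_seq ?addr0; last first.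
    move=> p /andP[]; rewrite mem_bounded_partitions -ltnNge => lt_k /and3P[_ _ le_k].
    by rewrite -subnDA (eqP lt_k) scale0r.
  have pk : perm_eq [seq p <- bounded_partitions k.+1 | (sumn p + size p <= k)%N]
                    (bounded_partitions k).
    apply: uniq_perm; rewrite ?(filter_uniq _ (bounded_partitions_uniq _)) //.
      exact: bounded_partitions_uniq.
    move=> p.
    rewrite mem_filter !mem_bounded_partitions; lia.
  rewrite -big_filter (perm_big _ pk) mulr_sumr; apply: eq_big_seq => p.
  rewrite mem_bounded_partitions => /and3P[_ _ le_k].
  rewrite /mon /cweight.
  have -> : (k.+1 - sumn p - size p = (k - sumn p - size p).+1)%N by rewrite -!subnDA subSn.
  rewrite factS natrM exprS scalerA -scalerAr; congr (_ *: _); last by ring.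
  by field; rewrite nat1r !pnatr_eq0 -!lt0n fact_gt0.
pose f (mp : nat * seq nat) :=
  cweight (k - mp.1) mp.2 *: (w mp.1.+1 * mon (k - mp.1)%N mp.2).
transitivity (\sum_(mp <- [seq (m, rem m p) | p <- bounded_partitions k.+1, m <- undup p]) f mp).
  by rewrite big_allpairs_dep.
rewrite (perm_big _ (remove_part_perm k)) big_allpairs_dep /=.
rewrite (iotaDl 1 0 k) big_map -[X in iota 0 X]subn0 big_mkord.
apply: eq_bigr => m _; rewrite mulr_sumr; apply: eq_bigr => p _.
by rewrite /f /= scalerAr.
Qed.

End CycleIndex.

(** * Sums over permutations and power sums *)

(** The recursion determines the sequence because [k.+1] is invertible in [R]. The bound [K] allows
    for permutation sums over [N] points, where the recursion is derived only below [N]. *)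
Lemma cycle_index_unique {R : realType} {A : comAlgType R} (w u : nat -> A) (K : nat) :
  u 0%N = 1 ->
  (forall k, (k < K)%N ->
     k.+1%:R *: u k.+1 = \sum_(m < k.+1) w m.+1 * u (k - m)%N) ->
  forall k, (k <= K)%N -> u k = cycle_index w k.
Proof.
move=> u0 uS; elim/ltn_ind => -[_ _|k IH kK]; first by rewrite u0 cycle_index0.
have k0 : k.+1%:R != 0 :> R by rewrite pnatr_eq0.
apply: (scalerI k0); rewrite uS // cycle_indexS; apply: eq_bigr => m _.
by rewrite IH // ?ltnS ?leq_subr // (leq_trans _ (ltnW kK)) // leq_subr.
Qed.

(** * The sum rule for the coefficients *)

Section SumRule.
Context (R : realType).

(** Both sides are the elementary symmetric polynomial of degree [j] evaluated at
    [0, 1, ..., k - 1]. *)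
Lemma ccoef_coef (k j : nat) :
  (\prod_(i < k) (1 + i%:R *: 'X) : {poly R})`_j = (ccoef k j)%:R.
Proof.
have -> : (ccoef k j)%:R = (mesym k R j).@[fun i : 'I_k => i%:R].
  have -> : ccoef k j = (\sum_(t : j.-tuple 'I_k | path ltn 0 [seq val i | i <- t])
      \prod_(i <- t) i)%N by [].
  rewrite mesym_tupleE natr_sum raddf_sum /=.
  rewrite [RHS](bigID (fun t : j.-tuple 'I_k => path ltn 0%N [seq val i | i <- t])) /=.
  (* The increasing tuples excluded from [ccoef] start with the entry 0, so their product
     vanishes. *)
  rewrite [X in _ = _ + X]big1 ?addr0; last first.
    move=> t /andP[]; rewrite /tmono; case: t => -[|i t] /= _ => // ti.
    rewrite ti andbT lt0n negbK => /eqP i0.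
    by rewrite big_cons rmorphM /= mevalXU i0 mul0r.
  rewrite [RHS](eq_bigl (fun t : j.-tuple 'I_k => path ltn 0%N [seq val i | i <- t])).
    apply: eq_bigr => t _; rewrite natr_prod rmorph_prod; apply: eq_bigr => i _.
    by rewrite /= mevalXU.
  by move=> t; rewrite andb_idl // /tmono => /path_sorted.
under eq_bigr do rewrite addrC.
rewrite bigA_distr coef_sum /mesym raddf_sum /= [RHS]big_mkcond /=.
apply: eq_bigr => h _; rewrite rmorph_prod /=.
rewrite -big_mkcond /= scaler_prod prodr_const coefZ coefXn eq_sym.
under [X in if _ then X else _]eq_bigr do rewrite mevalXU.
by case: eqP; rewrite ?mulr1 ?mulr0.
Qed.

Lemma cycle_index_Xn (k : nat) :
  k`!%:R *: cycle_index (fun m => 'X^(m.-1) : {poly R}) k =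
  \prod_(i < k) (1 + i%:R *: 'X).
Proof.
pose s n : {poly R} := \prod_(i < n) (1 + i%:R *: 'X).
have f0 n : n`!%:R != 0 :> R by rewrite pnatr_eq0 -lt0n fact_gt0.
(* This classifies permutations by the cycle of one chosen letter: its [m] other letters can be
   listed in [n! / (n - m)!] ways, and the cycle has weight ['X^m]. *)
have sS n : s n.+1 = \sum_(m < n.+1) ((n`!)%:R / (n - m)`!%:R) *: ('X^m * s (n - m)%N).
  elim: n => [|n IH].
    by rewrite big_ord1 /s big_ord1 /= big_ord0 divr1 scale1r scale0r addr0 mulr1.
  rewrite {1}/s big_ord_recr /= -/(s n.+1) mulrDr mulr1 big_ord_recl /=.
  rewrite subn0 divff // scale1r mul1r; congr (_ + _).
  rewrite {1}IH mulr_suml; apply: eq_bigr => m _ /=; rewrite subSS.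
  rewrite factS natrM exprSr -!scalerAl -!scalerAr !scalerA; congr (_ *: _); last by ring.
  by ring.
have <- : (k`!%:R)^-1 *: s k = cycle_index (fun m => 'X^(m.-1) : {poly R}) k.
  apply: (@cycle_index_unique _ _ _ (fun k => (k`!%:R)^-1 *: s k) k) => // [|n _].
    by rewrite /s big_ord0 invr1 scale1r.
  rewrite sS scalerA scaler_sumr; apply: eq_bigr => m _.
  rewrite scalerA -scalerAr; congr (_ *: _).
  by rewrite factS natrM; field; rewrite nat1r !f0 pnatr_eq0.
by rewrite scalerA divff // scale1r.
Qed.

(** With weight ['X^(m-1)] for a cycle of length [m], a partition [p] contributes to the coefficient
    of degree [sumn p] only; the rule is the comparison of coefficients of degree [j]. *)
Lemma sum_dcoef (k j : nat) :
  \sum_(p <- partitions j | (j + size p <= k)%N) dcoef k p = (ccoef k j)%:R :> R.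
Proof.
rewrite -ccoef_coef -cycle_index_Xn /cycle_index.
rewrite coefZ coef_sum sum_bounded_partitions.
have term p : ((cweight k p *: (\prod_(q <- p) 'X^(q.+1.-1) * 'X^(1.-1) ^+ (k - sumn p - size p)))
    : {poly R})`_j = if sumn p == j then cweight k p else 0.
  rewrite expr0 expr1n mulr1 coefZ.
  have -> : \prod_(q <- p) 'X^(q.+1.-1) = 'X^(sumn p) :> {poly R}.
    by elim: p => [|q p IH]; rewrite ?big_nil ?big_cons //= IH exprD.
  by rewrite coefXn eq_sym; case: eqP; rewrite ?mulr1 ?mulr0.
transitivity (k`!%:R * \sum_(p <- partitions j | (j + size p <= k)%N) cweight k p : R).
  by rewrite mulr_sumr; apply: eq_bigr => p _; rewrite dcoefE.
congr (_ * _); under [RHS]eq_bigr do under eq_bigr do rewrite term.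
have inner i : \sum_(p <- partitions i | (i + size p <= k)%N)
      (if sumn p == j then cweight k p else 0) =
    if i == j then \sum_(p <- partitions j | (j + size p <= k)%N) cweight k p else 0 :> R.
  case: eqP => [->|ij]; rewrite big_seq_cond.
    rewrite [RHS]big_seq_cond; apply: eq_bigr => p /andP[].
    by rewrite mem_partitions => /and3P[_ _ ->].
  rewrite big1 // => p /andP[]; rewrite mem_partitions => /and3P[_ _ /eqP ->].
  by move/eqP/negPf: ij => ->.
under [RHS]eq_bigr do rewrite inner.
rewrite -big_mkcond big_nat1_eq ltnS /=; case: leqP => // kj.
rewrite big1 // => p le_k; move: (leq_trans kj (leq_trans (leq_addr _ _) le_k)).
by rewrite ltnn.
Qed.

End SumRule.

Lemma card_ord_lt (N k : nat) : (k <= N)%N -> #|(fun i : 'I_N => (i < k)%N)| = k.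
Proof.
move=> kN; rewrite -sum1_card -[RHS]card_ord -sum1_card.
by rewrite (big_ord_widen _ (fun=> 1%N) kN); apply: eq_bigl.
Qed.

(** * Newton's identities for sums over permutations *)

Section PermutationSums.
Context {R : realType} {A : comAlgType R} (N : nat) (y : 'I_N -> A).

(** For [k <= N] this is [k! (N - k)!] times the elementary symmetric polynomial of degree [k] in
    the [y i]. *)
Definition perm_sum (k : nat) : A :=
  \sum_(s : 'S_N) \prod_(i < N | (i < k)%N) y (s i).

Definition perm_sum_pow (k m : nat) : A :=
  \sum_(s : 'S_N) (\prod_(i < N | (i < k)%N) y (s i)) *
                  \prod_(i < N | i == k :> nat) y (s i) ^+ m.

Definition power_sum (m : nat) : A := \sum_(i < N) y i ^+ m.

Lemma perm_sum0 : perm_sum 0 = N`!%:R.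
Proof.
rewrite /perm_sum (eq_bigr (fun=> 1)) => [|s _]; last by rewrite big_pred0.
by rewrite sumr_const card_Sn.
Qed.

Lemma perm_sumS (k : nat) : perm_sum k.+1 = perm_sum_pow k 1.
Proof.
apply: eq_bigr => s _; rewrite (bigID (fun i : 'I_N => (i < k)%N)) /=.
congr (_ * _); first by apply: eq_bigl => i; rewrite andb_idl // => /ltnW.
by apply: eq_big => [i|i _]; rewrite ?expr1 // -leqNgt ltnS -eqn_leq.
Qed.

(** The power sum runs over all positions [l]. Each of the [k] positions [l < k] raises the exponent
    of a factor already present; each of the [N - k] others brings a new factor. Relabelling the
    permutation by a transposition moves [l] to the standard position [k.-1] or [k]. *)
Lemma perm_sum_power_sum (k m : nat) : (k < N)%N ->
  perm_sum k * power_sum m =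
  k%:R * perm_sum_pow k.-1 m.+1 + (N - k)%:R * perm_sum_pow k m.
Proof.
move=> kN; rewrite /perm_sum mulr_suml.
have term (s : 'S_N) : (\prod_(i < N | (i < k)%N) y (s i)) * power_sum m =
    \sum_(l < N) (\prod_(i < N | (i < k)%N) y (s i)) * y (s l) ^+ m.
  by rewrite mulr_sumr /power_sum (reindex_inj (@perm_inj _ s)).
under eq_bigr do rewrite term; rewrite exchange_big /=.
rewrite (bigID (fun l : 'I_N => (l < k)%N)) /=; congr (_ + _).
- have Hl (l : 'I_N) : (l < k)%N -> \sum_(s : 'S_N)
      (\prod_(i < N | (i < k)%N) y (s i)) * y (s l) ^+ m = perm_sum_pow k.-1 m.+1.
    move=> lk; have k0 : (0 < k)%N by apply: leq_ltn_trans lk.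
    have kN' : (k.-1 < N)%N by rewrite prednK // ltnW.
    rewrite (reindex_inj (mulgI (tperm l (Ordinal kN')))) /=.
    apply: eq_bigr => s _; rewrite permM tpermL.
    rewrite (reindex_inj (@perm_inj _ (tperm l (Ordinal kN')))) /=.
    under eq_bigr do rewrite permM tpermK.
    rewrite (eq_bigl (fun i : 'I_N => (i < k)%N)); last first.
      by move=> i; case: tpermP => [->|->|//] /=; rewrite lk prednK ?leqnn.
    rewrite (bigID (fun i : 'I_N => (i < k.-1)%N)) /= -mulrA; congr (_ * _).
      by apply: eq_bigl => i; lia.
    rewrite (big_pred1 (Ordinal kN')) => [|i]; last by rewrite /= -val_eqE /=; lia.
    rewrite (big_pred1 (Ordinal kN')) => [|i]; last by rewrite /= -val_eqE.
    by rewrite exprS.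
  rewrite (eq_bigr _ Hl) sumr_const mulr_natl; congr (_ *+ _).
  exact/card_ord_lt/ltnW.
- have Hl (l : 'I_N) : ~~ (l < k)%N -> \sum_(s : 'S_N)
      (\prod_(i < N | (i < k)%N) y (s i)) * y (s l) ^+ m = perm_sum_pow k m.
    move=> lk.
    rewrite (reindex_inj (mulgI (tperm l (Ordinal kN)))) /=.
    apply: eq_bigr => s _; rewrite permM tpermL; congr (_ * _).
      apply: eq_bigr => i ik; rewrite permM tpermD //.
        by apply: contraNneq lk => ->.
      by apply: contraTneq ik => <-; rewrite ltnn.
    by rewrite (big_pred1 (Ordinal kN)) // => i; rewrite -val_eqE.
  rewrite (eq_bigr _ Hl) sumr_const mulr_natl; congr (_ *+ _).
  have := cardC (fun i : 'I_N => (i < k)%N).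
  rewrite card_ord (card_ord_lt (ltnW kN)) => cardN.
  by rewrite -[X in (X - _)%N]cardN addKn; apply: eq_card.
Qed.

(** After division by [k! (N - k)!] the permutation sums satisfy the recursion of the cycle index
    with weights [(-1)^(m-1) p_m]. *)
Lemma perm_sum_cycle_index (k : nat) : (k <= N)%N ->
  perm_sum k = (k`! * (N - k)`!)%:R *:
    cycle_index (fun m => (-1) ^+ m.-1 * power_sum m) k.
Proof.
have f0 n : n`!%:R != 0 :> R by rewrite pnatr_eq0 -lt0n fact_gt0.
(* Solving [perm_sum_power_sum] for its last term and iterating lowers [a] and raises [m], with a
   change of sign each time; the case [m = 1] is the recursion sought. *)
have pow_sum a m : (a < N)%N -> ((N - a.+1)`!%:R : R)^-1 *: perm_sum_pow a m =
    \sum_(l < a.+1) (a`!%:R / ((a - l)`!%:R * (N - (a - l))`!%:R)) *: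
      ((-1) ^+ l * power_sum (l + m) * perm_sum (a - l)).
  have div_fact (n : nat) (z : A) : (n < N)%N ->
      ((N - n.+1)`!%:R : R)^-1 *: z = ((N - n)`!%:R : R)^-1 *: ((N - n)%:R * z).
    move=> nN; rewrite mulr_natl -scaler_nat scalerA; congr (_ *: _).
    rewrite -(subnSK nN) factS natrM; field; rewrite nat1r f0 pnatr_eq0 //.
  elim: a m => [|a IH] m aN; rewrite div_fact //.
    have := perm_sum_power_sum m aN; rewrite mul0r add0r => <-.
    by rewrite big_ord1 /= fact0 !mul1r [_ * perm_sum _]mulrC.
  have /eqP := perm_sum_power_sum m aN; rewrite addrC -subr_eq => /eqP <-.
  rewrite scalerBr /= big_ord_recl /= subn0.
  congr (_ + _).
    by rewrite expr0 mul1r add0n [_ * perm_sum _]mulrC; congr (_ *: _); field; rewrite !f0.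
  rewrite mulr_natl -scaler_nat scalerA mulrC -scalerA IH ?(ltnW aN) //.
  rewrite scaler_sumr -sumrN; apply: eq_bigr => l _.
  rewrite /= subSS addSn addnS exprS mulN1r !mulNr scalerN; congr (- _).
  by rewrite scalerA factS natrM mulrA.
move=> kN.
have <- : ((k`! * (N - k)`!)%:R)^-1 *: perm_sum k =
    cycle_index (fun m => (-1) ^+ m.-1 * power_sum m) k.
  apply: (@cycle_index_unique _ _ _ (fun k => ((k`! * (N - k)`!)%:R)^-1 *: perm_sum k) N) => //.
    rewrite perm_sum0 fact0 mul1n subn0 -scaler_nat scalerA mulVf ?f0 //.
    exact: scale1r.
  move=> n nN; rewrite perm_sumS factS !natrM !invfM -!scalerA pow_sum //.
  rewrite scalerA scalerA mulrA divff ?pnatr_eq0 // mul1r.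
  rewrite scaler_sumr; apply: eq_bigr => l _ /=.
  rewrite addn1 -scalerAr scalerA; congr (_ *: _).
  by rewrite natrM; field; rewrite !f0.
by rewrite scalerA divff ?scale1r // pnatr_eq0 -lt0n muln_gt0 !fact_gt0.
Qed.

End PermutationSums.

(** * Measures on powers of [X] and their moments *)

Section Integral.
Context {R : realType} {V : lmodType R}.

(** Values in a module allow both numerical and polynomial integrands. *)
Definition integral {T : finType} (mu : smeasure R T) (phi : T -> V) : V :=
  \sum_t (mu t : R) *: phi t.

Lemma integral_pushforward (T U : finType) (f : T -> U) (mu : smeasure R T)
    (phi : U -> V) :
  integral (pushforward f mu) phi = integral mu (phi \o f).
Proof.
rewrite /integral [RHS](partition_big f xpredT) //=; apply: eq_bigr => y _.
rewrite ffunE /mass scaler_suml; apply: eq_big => [x|x]; first by rewrite !inE.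
by rewrite !inE => /eqP ->.
Qed.

Lemma integral_dirac (T : finType) (a : T) (phi : T -> V) :
  integral (dirac a) phi = phi a.
Proof.
rewrite /integral (bigD1 a) //= ffunE eqxx scale1r big1 ?addr0 // => t /negPf ta.
by rewrite ffunE ta scale0r.
Qed.

Lemma integralD (T : finType) (mu nu : smeasure R T) (phi : T -> V) :
  integral (mu + nu) phi = integral mu phi + integral nu phi.
Proof.
by rewrite /integral -big_split; apply: eq_bigr => t _; rewrite ffunE scalerDl.
Qed.

Lemma integralZ (T : finType) (c : R) (mu : smeasure R T) (phi : T -> V) :
  integral (c *: mu) phi = c *: integral mu phi.
Proof.
by rewrite /integral scaler_sumr; apply: eq_bigr => t _; rewrite ffunE scalerA.
Qed.

Lemma integral_sum (T : finType) (I : Type) (r : seq I) (P : pred I)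
    (mu : I -> smeasure R T) (phi : T -> V) :
  integral (\sum_(i <- r | P i) mu i) phi = \sum_(i <- r | P i) integral (mu i) phi.
Proof.
rewrite /integral exchange_big; apply: eq_bigr => t _.
by rewrite sum_ffunE scaler_suml.
Qed.

Lemma integral_marginal (X : finType) (n k : nat) (g : smeasure R (n.-tuple X))
    (phi : seq X -> V) : (k <= n)%N ->
  integral (marginal k g) (fun t => phi t) = integral g (fun u => phi (take k u)).
Proof.
move=> kn; rewrite /integral; under eq_bigr do rewrite ffunE /mass scaler_suml.
rewrite (exchange_big_dep xpredT) //=; apply: eq_bigr => u _.
have tk : size (take k u) == k by rewrite size_takel // size_tuple.
rewrite (big_pred1 (Tuple tk)) // => t; rewrite inE /= -val_eqE /=; exact: eq_sym.
Qed.

End Integral.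

Lemma average_const {R : realType} {V : lmodType R} (n : nat) (v : V) :
  (n`!%:R : R)^-1 *: \sum_(s : 'S_n) v = v.
Proof.
rewrite sumr_const card_Sn -[v *+ _]scaler_nat scalerA mulVf ?scale1r //.
by rewrite pnatr_eq0 -lt0n fact_gt0.
Qed.

Section Symmetrization.
Context {R : realType} {X : finType}.

Definition permute_tuple {n : nat} (t : n.-tuple X) (s : 'S_n) : n.-tuple X :=
  [tuple tnth t (s i) | i < n].

Lemma permute_tupleM n (t : n.-tuple X) (s u : 'S_n) :
  permute_tuple (permute_tuple t s) u = permute_tuple t (u * s)%g.
Proof. by apply: eq_from_tnth => i; rewrite !tnth_mktuple permM. Qed.

Lemma permute_tupleK n (s : 'S_n) :
  cancel (fun t : n.-tuple X => permute_tuple t s) (fun t => permute_tuple t s^-1%g).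
Proof.
by move=> t; rewrite permute_tupleM mulVg; apply: eq_from_tnth => i; rewrite tnth_mktuple perm1.
Qed.

Lemma permute_tupleKV n (s : 'S_n) :
  cancel (fun t : n.-tuple X => permute_tuple t s^-1%g) (fun t => permute_tuple t s).
Proof. by move=> t; rewrite -{2}[s]invgK; apply: permute_tupleK. Qed.

Lemma perm_permute_tuple n (t : n.-tuple X) (s : 'S_n) : perm_eq (permute_tuple t s) t.
Proof. by apply/tuple_permP; exists s. Qed.

Lemma perm_permute_tupleP n (t u : n.-tuple X) :
  reflect (exists s, u = permute_tuple t s) (perm_eq u t).
Proof.
apply: (iffP tuple_permP) => -[s us]; exists s; last by rewrite us.
exact: val_inj.
Qed.

(** Pushing forward along [s] evaluates [g] at the tuple permuted by the inverse of [s]; summing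
    over the whole group absorbs the inverse. *)
Lemma symmetrizeE n (g : smeasure R (n.-tuple X)) t :
  symmetrize g t = (n`!%:R)^-1 * \sum_(s : 'S_n) g (permute_tuple t s).
Proof.
rewrite ffunE sum_ffunE; congr (_ * _); rewrite [RHS](reindex_inj (@invg_inj ('S_n))).
apply: eq_bigr => s _; rewrite ffunE /mass (big_pred1 (permute_tuple t s^-1%g)) // => u.
rewrite !inE; apply/eqP/eqP => [<-|->]; last exact: permute_tupleKV.
exact/esym/permute_tupleK.
Qed.

Lemma symmetrize_permute n (g : smeasure R (n.-tuple X)) t s :
  symmetrize g (permute_tuple t s) = symmetrize g t.
Proof.
rewrite !symmetrizeE [in RHS](reindex_inj (mulIg s)) /=; congr (_ * _).
by apply: eq_bigr => u _; rewrite permute_tupleM.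
Qed.

Lemma symmetrize_id n (g : smeasure R (n.-tuple X)) :
  (forall t s, g (permute_tuple t s) = g t) -> symmetrize g = g.
Proof.
move=> gs; apply/ffunP => t; rewrite symmetrizeE (eq_bigr (fun=> g t)) //.
exact: (@average_const R R^o).
Qed.

Lemma symmetrize_idem n (g : smeasure R (n.-tuple X)) :
  symmetrize (symmetrize g) = symmetrize g.
Proof. by apply: symmetrize_id => t s; apply: symmetrize_permute. Qed.

Lemma symmetrizeD n (g h : smeasure R (n.-tuple X)) :
  symmetrize (g + h) = symmetrize g + symmetrize h.
Proof.
apply/ffunP => t; rewrite [RHS]ffunE !symmetrizeE -mulrDr -big_split; congr (_ * _).
by apply: eq_bigr => s _; rewrite ffunE.
Qed.

Lemma symmetrizeZ n (c : R) (g : smeasure R (n.-tuple X)) :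
  symmetrize (c *: g) = c *: symmetrize g.
Proof.
apply/ffunP => t; rewrite [RHS]ffunE !symmetrizeE mulr_sumr mulr_sumr scaler_sumr.
by apply: eq_bigr => s _; rewrite ffunE mulrCA.
Qed.

Lemma symmetrize0 n : symmetrize (0 : smeasure R (n.-tuple X)) = 0.
Proof. by rewrite -(scale0r 0) symmetrizeZ !scale0r. Qed.

Lemma symmetrize_sum n (I : Type) (r : seq I) (P : pred I)
    (g : I -> smeasure R (n.-tuple X)) :
  symmetrize (\sum_(i <- r | P i) g i) = \sum_(i <- r | P i) symmetrize (g i).
Proof. exact: (big_morph _ (@symmetrizeD n) (@symmetrize0 n)). Qed.

Lemma integral_symmetrize (V : lmodType R) n (g : smeasure R (n.-tuple X))
    (phi : n.-tuple X -> V) :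
  integral (symmetrize g) phi =
  (n`!%:R)^-1 *: \sum_(s : 'S_n) integral g (fun t => phi (permute_tuple t s)).
Proof.
rewrite integralZ integral_sum; congr (_ *: _).
by apply: eq_bigr => s _; rewrite integral_pushforward.
Qed.

End Symmetrization.

(** * Moments as a multiplicative transform *)

Section Moments.
Context {R : realType} {X : finType} {A : comAlgType R} (Y : X -> A).

Definition moment {n : nat} (mu : smeasure R (n.-tuple X)) : A :=
  integral mu (fun t => \prod_(a <- t) Y a).

Definition point_moment (lam : smeasure R X) (m : nat) : A :=
  integral lam (fun a => Y a ^+ m).

Lemma moment_tensor m n (mu : smeasure R (m.-tuple X)) (nu : smeasure R (n.-tuple X)) :
  moment (tensor mu nu) = moment mu * moment nu.
Proof.
rewrite /moment integral_pushforward /integral mulr_suml.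
under [RHS]eq_bigr do rewrite mulr_sumr.
rewrite pair_bigA; apply: eq_bigr => -[t u] _ /=.
by rewrite ffunE big_cat /= -scalerAl -scalerAr scalerA.
Qed.

Lemma moment_retype m n (mu : smeasure R (m.-tuple X)) : m = n ->
  moment (retype n mu) = moment mu.
Proof.
move=> e; case: n / e; apply: eq_bigr => t _.
by rewrite -[t in LHS](tcast_id (erefl m)) retypeE tcast_id.
Qed.

Lemma moment_diagonal lam m : moment (diagonal lam m) = point_moment lam m.
Proof.
rewrite /moment integral_pushforward; apply: eq_bigr => a _ /=.
by rewrite big_nseq iter_mulr_1.
Qed.

Lemma moment_power lam m : moment (power lam m) = point_moment lam 1 ^+ m.
Proof.
rewrite -[X in _ ^+ X]card_ord -prodr_const /point_moment /integral bigA_distr_bigA /=.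
rewrite /moment /integral.
rewrite (reindex (fun f : {ffun 'I_m -> X} => [tuple f i | i < m])) /=.
  apply: eq_bigr => f _; rewrite ffunE scaler_prod; congr (_ *: _).
    by apply: eq_bigr => i _; rewrite tnth_mktuple.
  rewrite big_map big_enum; apply: eq_bigr => i _; exact: esym (expr1 _).
exists (fun t : m.-tuple X => [ffun i => tnth t i]) => [f|t] _.
  by apply/ffunP => i; rewrite ffunE tnth_mktuple.
by apply: eq_from_tnth => i; rewrite tnth_mktuple ffunE.
Qed.

Lemma moment_block_product lam p r :
  moment (block_product lam p r) =
  \prod_(q <- p) point_moment lam q.+1 * point_moment lam 1 ^+ r.
Proof.
elim: p => [|q p IH] /=; first by rewrite moment_power big_nil mul1r.
by rewrite moment_tensor moment_diagonal IH big_cons mulrA.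
Qed.

Lemma moment_Ppoly (k j : nat) lam :
  moment (Ppoly k j lam) =
  \sum_(p <- partitions j | (j + size p <= k)%N)
    dcoef k p *: (\prod_(q <- p) point_moment lam q.+1 *
                  point_moment lam 1 ^+ (k - j - size p)).
Proof.
rewrite /moment integral_sum big_seq_cond [RHS]big_seq_cond; apply: eq_bigr => p.
rewrite mem_partitions => /andP[/and3P[_ _ /eqP pj] le_k].
rewrite integralZ -/(moment _) moment_retype ?moment_block_product //.
by rewrite arityE pj -subnDA subnKC.
Qed.

End Moments.

(* With indeterminates for [Y], the moment of [mu] is the generating polynomial
   of the masses that [mu] gives to the orbits of the symmetric group. *)
Lemma moment_symmetrize_inj {R : realType} {X : finType} n
    (mu nu : smeasure R (n.-tuple X)) :
  let Y (a : X) : {mpoly R[#|X|]} := 'X_(enum_rank a) in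
  moment Y mu = moment Y nu -> symmetrize mu = symmetrize nu.
Proof.
move=> Y.
(* The exponent vector records the multiplicity of each point in [t], hence [t] up to order. *)
pose mon (t : n.-tuple X) : 'X_{1..#|X|} := (\sum_(a <- t) U_(enum_rank a))%MM.
have prodY (t : n.-tuple X) : \prod_(a <- t) Y a = 'X_[mon t] by rewrite /Y mprodXE.
have mon_perm (t u : n.-tuple X) : (mon u == mon t) = perm_eq u t.
  have countE (v : n.-tuple X) a : mon v (enum_rank a) = count_mem a v.
    rewrite mnm_sumE -sum1_count [RHS]big_mkcond; apply: eq_bigr => b _.
    by rewrite mnm1E (inj_eq enum_rank_inj) /=; case: eqP.
  apply/eqP/idP => [e|ut]; last exact: perm_big.
  by apply/allP => a _ /=; rewrite -!countE e.
have coefE (g : smeasure R (n.-tuple X)) t :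
    (moment Y g)@_(mon t) = \sum_(u : n.-tuple X | perm_eq u t) g u.
  rewrite raddf_sum [RHS]big_mkcond; apply: eq_bigr => u _ /=.
  by rewrite prodY mcoeffZ mcoeffX mon_perm; case: ifP; rewrite ?mulr1 ?mulr0.
move=> e; apply/ffunP => t; rewrite !symmetrizeE; congr (_ * _).
have orbitE (g : smeasure R (n.-tuple X)) : \sum_(s : 'S_n) g (permute_tuple t s) =
    (moment Y g)@_(mon t) *+ #|[set s : 'S_n | permute_tuple t s == t]|.
  rewrite coefE.
  rewrite (partition_big (permute_tuple t) (fun u : n.-tuple X => perm_eq u t)) /=; last first.
    by move=> s _; apply: perm_permute_tuple.
  rewrite -sumrMnl; apply: eq_bigr => _ /perm_permute_tupleP[s ->].
  rewrite (eq_bigr (fun=> g (permute_tuple t s))) => [|v /eqP -> //].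
  rewrite sumr_const; congr (_ *+ _).
  (* The permutations sending [t] to a given rearrangement form a coset of the stabilizer of [t], so
     every point of the orbit is hit equally often. *)
  rewrite -[RHS](card_imset _ (mulgI s)); apply: eq_card => v.
  apply/idP/imsetP.
    move=> /eqP/val_inj vs; exists (s^-1 * v)%g; last by rewrite mulVKg.
    by rewrite inE -permute_tupleM vs permute_tupleK.
  by case=> u; rewrite inE => /eqP ut ->; rewrite unfold_in; apply/eqP; rewrite -permute_tupleM ut.
by rewrite !orbitE e.
Qed.

(** * Marginals of symmetrized Dirac measures *)

Section PowerSumFormulas.
Context {R : realType} {A : comAlgType R} (N : nat) (y : 'I_N -> A).

Lemma perm_sum1 : (0 < N)%N -> N%:R * perm_sum y 1 = N`!%:R * power_sum y 1.
Proof.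
move=> N0; have := perm_sum_power_sum y 1 N0.
by rewrite perm_sum0 perm_sumS mul0r add0r subn0.
Qed.

(** The identity [2 e_2 = p_1^2 - p_2]; at indicator values it expresses the number of ordered pairs
    of coordinates equal to a given point. *)
Lemma perm_sum2 : (1 < N)%N ->
  (N * N.-1)%:R * perm_sum y 2 = N`!%:R * (power_sum y 1 ^+ 2 - power_sum y 2).
Proof.
move=> N1; have e1 := perm_sum_power_sum y 1 N1.
have e0 := perm_sum_power_sum y 2 (ltnW N1).
have e2 := perm_sum1 (ltnW N1).
rewrite mul0r add0r subn0 perm_sum0 in e0; rewrite -perm_sumS mul1r subn1 /= in e1.
rewrite natrM -mulrA mulrBr e0 expr2 [in RHS]mulrA -e2 -mulrA e1.
by rewrite mulrDr addrAC subrr add0r.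
Qed.

End PowerSumFormulas.

Section Marginals.
Context {R : realType} {X : finType}.

Lemma prod_take {A : comNzRingType} (n m : nat) (t : n.-tuple X) (F : X -> A) :
  (m <= n)%N ->
  \prod_(a <- take m t) F a = \prod_(i < n | (i < m)%N) F (tnth t i).
Proof.
move=> mn; case: n => [|n] in t mn *.
  by rewrite big_ord0 (tuple0 t) /= big_nil.
pose x0 := tnth t ord0.
under [RHS]eq_bigr do rewrite (tnth_nth x0).
rewrite -(big_ord_widen _ (fun i => F (nth x0 t i))) //.
rewrite (big_nth x0) size_takel ?size_tuple // big_mkord.
by apply: eq_bigr => i _; rewrite nth_take.
Qed.

(** For symmetric [g] the product over the first [m] coordinates may be averaged over all
    permutations of the coordinates. *)
Lemma integral_marginal_prod_take {A : comAlgType R} (n k m : nat)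
    (g : smeasure R (n.-tuple X)) (Y : X -> A) : (m <= k <= n)%N ->
  symmetrize g = g ->
  integral (marginal k g) (fun t => \prod_(a <- take m t) Y a) =
  integral g (fun u => (n`!%:R)^-1 *: perm_sum (fun i => Y (tnth u i)) m).
Proof.
case/andP=> mk kn gs.
rewrite (integral_marginal g (fun s => \prod_(a <- take m s) Y a)) //.
rewrite -{1}gs integral_symmetrize /integral exchange_big scaler_sumr.
apply: eq_bigr => u _; rewrite -scaler_sumr scalerA mulrC -scalerA.
congr (_ *: (_ *: _)); apply: eq_bigr => s _.
rewrite take_takel // prod_take ?(leq_trans mk) //.
by apply: eq_bigr => i _; rewrite tnth_mktuple.
Qed.

Lemma moment_marginal_dirac {A : comAlgType R} (n k : nat) (x : n.-tuple X)
    (Y : X -> A) : (k <= n)%N ->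
  moment Y (marginal k (symmetrize (dirac x))) =
  (n`!%:R)^-1 *: perm_sum (fun i => Y (tnth x i)) k.
Proof.
move=> kn; transitivity (integral (marginal k (symmetrize (dirac x)))
    (fun t : k.-tuple X => \prod_(a <- take k t) Y a)).
  by apply: eq_bigr => t _; rewrite take_oversize // size_tuple.
rewrite integral_marginal_prod_take ?leqnn // ?symmetrize_idem //.
rewrite integral_symmetrize (eq_bigr (fun=> (n`!%:R)^-1 *: perm_sum (fun i => Y (tnth x i)) k)).
  exact: average_const.
move=> s _; rewrite integral_dirac; congr (_ *: _).
(* A permutation sum does not depend on the order of the points of [x]. *)
rewrite /perm_sum (reindex_inj (mulIg s^-1%g)) /=; apply: eq_bigr => u _.
by apply: eq_bigr => i _; rewrite tnth_mktuple permM permKV.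
Qed.

Lemma smeasure_integral {T : finType} (mu : smeasure R T) (a : T) :
  mu a = integral mu (fun b => (b == a)%:R : R^o).
Proof.
rewrite /integral (bigD1 a) //= eqxx big1 ?addr0; first exact: esym (mulr1 _).
by move=> b /negPf ->; apply: mulr0.
Qed.

Lemma marginal1E (n : nat) (g : smeasure R (n.-tuple X)) (a : X) : (0 < n)%N ->
  marginal1 g a =
  integral g (fun u => \prod_(b <- take 1 u) (b == a)%:R : R^o).
Proof.
move=> n0; rewrite smeasure_integral integral_pushforward.
rewrite -(integral_marginal g (fun s => \prod_(b <- s) (b == a)%:R)) //.
apply: eq_bigr => t _; congr (_ *: _); case/tupleP: t => b t.
by rewrite (tuple0 t) /= theadE big_seq1.
Qed.

Definition empirical (n : nat) (x : n.-tuple X) : smeasure R X :=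
  n%:R^-1 *: \sum_(i < n) dirac (tnth x i).

(** With [Y] the indicator of a point [a], the mass at [a] becomes a moment of degree one, given by
    [perm_sum1]. *)
Lemma marginal1_marginal_dirac (n k : nat) (x : n.-tuple X) : (0 < k <= n)%N ->
  marginal1 (marginal k (symmetrize (dirac x))) = empirical x.
Proof.
case/andP=> k0 kn; have n0 := leq_trans k0 kn.
apply/ffunP => a.
transitivity (moment (fun b => (b == a)%:R : R^o) (marginal 1 (symmetrize (dirac x)))).
  rewrite marginal1E // (integral_marginal (symmetrize (dirac x))
    (fun s => \prod_(b <- take 1 s) (b == a)%:R : R^o)) //.
  rewrite /moment (integral_marginal _ (fun s => \prod_(b <- s) (b == a)%:R)) //.
  by apply: eq_bigr => u _; rewrite take_takel.
rewrite moment_marginal_dirac //.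
have := perm_sum1 (fun i => (tnth x i == a)%:R : R^o) n0.
rewrite !ffunE sum_ffunE; set P := perm_sum _ _ => e.
have -> : \sum_(i < n) (dirac (tnth x i) : smeasure R X) a =
     power_sum (fun i => (tnth x i == a)%:R : R^o) 1.
  by apply: eq_bigr => i _; rewrite ffunE expr1 eq_sym.
have nn0 : n%:R != 0 :> R by rewrite pnatr_eq0 -lt0n.
have f0 : n`!%:R != 0 :> R by rewrite pnatr_eq0 -lt0n fact_gt0.
apply: (mulfI nn0); rewrite [RHS]mulVKf // -[LHS](mulKf f0) [_ * (n%:R * _)]mulrCA.
by rewrite [X in n%:R * X]mulVKf // e mulKf.
Qed.

Lemma marginalE (n k : nat) (g : smeasure R (n.-tuple X)) (t : k.-tuple X) :
  marginal k g t = \sum_(u : n.-tuple X | take k u == t :> seq X) g u.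
Proof. by rewrite ffunE; apply: eq_bigl => u; rewrite inE. Qed.

Lemma symmetrize_marginal (n k : nat) (g : smeasure R (n.-tuple X)) :
  (k <= n)%N -> symmetrize g = g -> symmetrize (marginal k g) = marginal k g.
Proof.
move=> kn gs; apply: symmetrize_id => t s; rewrite !marginalE.
move: (permute_tuple t s) (perm_permute_tuple t s) => t' tt'.
(* Replacing the first [k] coordinates of [u] by [v] maps the tuples with prefix [t] bijectively to
   those with prefix [t'], and only permutes coordinates. The length is always right, so the default
   of [insubd] is never taken. *)
pose h (v : k.-tuple X) (u : n.-tuple X) := insubd u (v ++ drop k u).
have hE v u : h v u = v ++ drop k u :> seq X.
  by rewrite insubdK // unfold_in size_cat size_drop !size_tuple subnKC.
have takeh v u : take k (h v u) = v by rewrite hE take_size_cat ?size_tuple.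
have hK (v w : k.-tuple X) (u : n.-tuple X) : take k u = v :> seq X -> h v (h w u) = u.
  move=> uv; apply: val_inj; rewrite /= hE (hE w u) drop_size_cat ?size_tuple //.
  by rewrite -uv cat_take_drop.
rewrite (reindex_onto (h t') (h t)) /=; last first.
  by move=> u /eqP ut; rewrite (hK _ t u ut).
apply: eq_big => [u|u /andP[_ /eqP ut]].
  rewrite takeh eqxx /=; apply/eqP/eqP => [<-|ut]; [exact: takeh|exact: (hK _ _ _ ut)].
have /perm_permute_tupleP[r ->] : perm_eq (h t' u) u.
  have tu : take k u = t by rewrite -ut takeh.
  by rewrite hE -{2}(cat_take_drop k u) tu perm_cat2r.
by rewrite -[in LHS]gs symmetrize_permute gs.
Qed.

Lemma symmetrize_power (lam : smeasure R X) (k : nat) :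
  symmetrize (power lam k) = power lam k.
Proof.
apply: symmetrize_id => t s; rewrite !ffunE [RHS](reindex_inj (@perm_inj _ s)).
by apply: eq_bigr => i _; rewrite tnth_mktuple.
Qed.

Lemma power_sum_point_moment {A : comAlgType R} (n m : nat) (x : n.-tuple X)
    (Y : X -> A) : (0 < n)%N ->
  power_sum (fun i => Y (tnth x i)) m = n%:R * point_moment Y (empirical x) m.
Proof.
move=> n0; rewrite /point_moment integralZ integral_sum mulr_natl -scaler_nat scalerA.
rewrite divff ?pnatr_eq0 -?lt0n // scale1r.
by apply: eq_bigr => i _; rewrite integral_dirac.
Qed.

Lemma prod_fact (N k : nat) : (0 < k <= N)%N ->
  N%:R * \prod_(1 <= i < k) (N%:R - i%:R) * ((N - k)`!)%:R = N`!%:R :> R.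
Proof.
case/andP; elim: k => [//|[|k] IH] _ kN.
  by rewrite big_geq // mulr1 -natrM subn1; case: N kN {IH} => //= n _; rewrite factS.
rewrite -IH ?(ltnW kN) // big_nat_recr //= mulrA -[LHS]mulrA; congr (_ * _).
by rewrite -natrB ?(ltnW kN) // -natrM -(subnSK kN) factS.
Qed.

(** Both sides are symmetric, so it suffices to compare moments: a permutation sum on the left, its
    cycle index expansion on the right. *)
Lemma marginal_dirac_Fmap (N k : nat) (x : N.-tuple X) : (0 < k <= N)%N ->
  marginal k (symmetrize (dirac x)) = Fmap N k (empirical x).
Proof.
move=> kN; have [k0 le_kN] := andP kN; have N0 := leq_trans k0 le_kN.
have Nn0 : N%:R != 0 :> R by rewrite pnatr_eq0 -lt0n.
have f0 n : n`!%:R != 0 :> R by rewrite pnatr_eq0 -lt0n fact_gt0.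
set lam := empirical x.
pose Q : smeasure R (k.-tuple X) := (N%:R ^+ k.-1 / \prod_(1 <= i < k) (N%:R - i%:R)) *:
  (power lam k + \sum_(1 <= j < k) ((-1) ^+ j / N%:R ^+ j) *: Ppoly k j lam).
have -> : Fmap N k lam = symmetrize Q.
  rewrite symmetrizeZ symmetrizeD symmetrize_power symmetrize_sum.
  by congr (_ *: (_ + _)); apply: eq_bigr => j _; rewrite symmetrizeZ.
rewrite -(symmetrize_marginal le_kN (symmetrize_idem _)).
apply: moment_symmetrize_inj; set Y := fun a : X => _.
rewrite moment_marginal_dirac // perm_sum_cycle_index // scalerA.
set w := fun m => _; pose h := point_moment Y lam.
have wE m : w m.+1 = ((-1) ^+ m * N%:R : R) *: h m.+1.
  rewrite /w /= power_sum_point_moment // -/lam -/(h _).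
  rewrite -[in LHS]signr_odd -[in RHS]signr_odd; case: odd.
    by rewrite expr1 !mulN1r scaleNr scaler_nat mulr_natl.
  by rewrite expr0 !mul1r scaler_nat mulr_natl.
have signE (p : seq nat) :
    \prod_(q <- p) ((-1) ^+ q * N%:R) = (-1) ^+ sumn p * N%:R ^+ size p :> R.
  elim: p => [|q p IH]; first by rewrite big_nil mulr1.
  by rewrite big_cons IH /= exprD exprS mulrACA.
(* Each part and each fixed letter contributes one factor [N], in total [N ^ (k - sumn p)]; this is
   where the factor [(-1)^j / N^j] comes from. *)
have monE (p : seq nat) : (sumn p + size p <= k)%N ->
    \prod_(q <- p) w q.+1 * w 1%N ^+ (k - sumn p - size p) =
    ((-1) ^+ sumn p / N%:R ^+ sumn p * N%:R ^+ k : R) *: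
    (\prod_(q <- p) h q.+1 * h 1%N ^+ (k - sumn p - size p)).
  move=> le_k; rewrite wE expr0 mul1r exprZn (eq_bigr _ (fun q _ => wE q)).
  rewrite scaler_prod -scalerAl -scalerAr scalerA signE; congr (_ *: _).
  have -> : N%:R ^+ k = N%:R ^+ sumn p * (N%:R ^+ size p * N%:R ^+ (k - sumn p - size p)) :> R.
    by rewrite -!exprD -subnDA addnA subnKC.
  by rewrite -!mulrA mulKf // expf_neq0.
rewrite /moment integralZ integralD integral_sum -!/(moment _ _) moment_power -/(h _).
rewrite /cycle_index sum_bounded_partitions_gt0 // monE //= !subn0 expr0.
rewrite expr0 divr1 mul1r big_nil mul1r scalerDr [in RHS]scalerDr.
(* The common factor is the prefactor of [Fmap] times [k!], and [k!] turns [cweight] into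
   [dcoef]. *)
have const : (N`!%:R)^-1 * (k`! * (N - k)`!)%:R * N%:R ^+ k =
   N%:R ^+ k.-1 / \prod_(1 <= i < k) (N%:R - i%:R) * k`!%:R :> R.
  rewrite -(prod_fact kN) natrM.
  have -> : N%:R ^+ k = N%:R * N%:R ^+ k.-1 :> R by rewrite -exprS prednK.
  have := f0 N; rewrite -(prod_fact kN) !mulf_eq0 !negb_or => /andP[/andP[_ p0] q0].
  by field; rewrite p0 q0 Nn0.
congr (_ + _).
  rewrite !scalerA mulrAC const; congr (_ *: _).
  by rewrite /cweight /= !subn0 !big_nil !mulr1 mulfK ?f0.
rewrite !scaler_sumr; apply: eq_big_nat => j /andP[j0 jk].
rewrite integralZ -/(moment _ _) moment_Ppoly -/h !scaler_sumr.
rewrite big_seq_cond [RHS]big_seq_cond; apply: eq_bigr => p.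
rewrite mem_partitions => /andP[/and3P[_ _ /eqP pj] le_k].
rewrite monE pj // dcoefE !scalerA; congr (_ *: _).
have -> : (N`!%:R)^-1 * (k`! * (N - k)`!)%:R * cweight k p * ((-1) ^+ j / N%:R ^+ j * N%:R ^+ k)
  = ((N`!%:R)^-1 * (k`! * (N - k)`!)%:R * N%:R ^+ k) * cweight k p * ((-1) ^+ j / N%:R ^+ j) :> R.
  by ring.
by rewrite const; ring.
Qed.

End Marginals.

(** * Positivity and extreme points *)

Section Positivity.
Context {R : realType}.

Definition nonneg {T : finType} (mu : smeasure R T) : Prop :=
  forall t, 0 <= (mu t : R).

Lemma mass_nonneg (T : finType) (mu : smeasure R T) (S : {set T}) :
  nonneg mu -> 0 <= mass mu S.
Proof. by move=> mu0; apply: sumr_ge0. Qed.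

Lemma is_probabilityP (T : finType) (mu : smeasure R T) :
  is_probability mu <-> nonneg mu /\ \sum_t mu t = 1 :> R.
Proof.
have massT : mass mu [set: T] = \sum_t mu t by apply: eq_bigl => t; rewrite inE.
rewrite /is_probability massT; split=> -[mu0 mu1]; split=> //.
  by move=> t; have := mu0 [set t]; rewrite /mass big_set1.
by move=> S; apply: mass_nonneg.
Qed.

(** For a nonnegative measure the supremum is attained at the whole space. *)
Lemma tv_norm_nonneg (T : finType) (mu : smeasure R T) :
  nonneg mu -> tv_norm mu = mass mu [set: T].
Proof.
move=> mu0.
have mass0 (S : {set T}) : mass (0 : smeasure R T) S = 0.
  by rewrite /mass big1 // => t _; rewrite ffunE.
have normE (S : {set T}) : `|mass mu S - mass 0 S| = mass mu S.
  by rewrite mass0 subr0 ger0_norm // mass_nonneg.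
have le_massT (S : {set T}) : mass mu S <= mass mu [set: T].
  have -> : mass mu [set: T] = mass mu S + \sum_(t | t \notin S) (mu t : R).
    rewrite /mass (bigID (mem S)) /=.
    by congr (_ + _); apply: eq_bigl => t; rewrite inE.
  by rewrite lerDl sumr_ge0.
apply/le_anti/andP; split.
  apply: ge_sup; first by exists (mass mu set0), set0; rewrite ?normE.
  by move=> _ [S _ <-]; rewrite normE.
apply: ub_le_sup; last by exists setT; rewrite ?normE.
by exists (mass mu setT) => _ [S _ <-]; rewrite normE.
Qed.

Lemma pushforward_nonneg (T U : finType) (f : T -> U) (mu : smeasure R T) :
  nonneg mu -> nonneg (pushforward f mu).
Proof. by move=> mu0 y; rewrite ffunE mass_nonneg. Qed.

Lemma dcoef_gt0 (k : nat) (p : seq nat) : 0 < dcoef k p :> R.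
Proof.
have fact_pos n : 0 < n`!%:R :> R by rewrite ltr0n fact_gt0.
apply: mulr_gt0; last by apply: prodr_gt0 => q _; rewrite invr_gt0.
apply: mulr_gt0; last by apply: prodr_gt0 => q _; rewrite invr_gt0 ltr0n.
exact: divr_gt0.
Qed.

Section Plans.
Context {X : finType}.

Lemma symmetrize_nonneg n (g : smeasure R (n.-tuple X)) :
  nonneg g -> nonneg (symmetrize g).
Proof.
by move=> g0 t; rewrite symmetrizeE mulr_ge0 ?invr_ge0 ?ler0n // sumr_ge0.
Qed.

Lemma marginal_nonneg n k (g : smeasure R (n.-tuple X)) :
  nonneg g -> nonneg (marginal k g).
Proof. by move=> g0 t; rewrite ffunE mass_nonneg. Qed.

Lemma power_nonneg (lam : smeasure R X) m : nonneg lam -> nonneg (power lam m).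
Proof. by move=> lam0 t; rewrite ffunE prodr_ge0. Qed.

Lemma tensor_nonneg m n (mu : smeasure R (m.-tuple X)) (nu : smeasure R (n.-tuple X)) :
  nonneg mu -> nonneg nu -> nonneg (tensor mu nu).
Proof.
by move=> mu0 nu0; apply: pushforward_nonneg => z; rewrite ffunE mulr_ge0.
Qed.

Lemma Ppoly_nonneg k j (lam : smeasure R X) : nonneg lam -> nonneg (Ppoly k j lam).
Proof.
move=> lam0 t; rewrite sum_ffunE sumr_ge0 // => p _; rewrite ffunE.
apply: mulr_ge0; first exact/ltW/dcoef_gt0.
rewrite ffunE sumr_ge0 // => u _; elim: p (_ - _)%N u => [|q p IH] r; first exact: power_nonneg.
by apply: tensor_nonneg => [|v]; [exact: pushforward_nonneg|exact: IH].
Qed.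

Lemma empirical_nonneg n (x : n.-tuple X) : nonneg (empirical x : smeasure R X).
Proof.
move=> a; rewrite ffunE sum_ffunE mulr_ge0 ?invr_ge0 ?ler0n // sumr_ge0 // => i _.
by rewrite ffunE ler0n.
Qed.

(** The total mass is the moment for [Y = 1], where every point moment equals 1; what remains is the
    sum rule. *)
Lemma mass_Ppoly_empirical n k j (x : n.-tuple X) : (0 < n)%N ->
  mass (Ppoly k j (empirical x : smeasure R X)) [set: k.-tuple X] = (ccoef k j)%:R.
Proof.
move=> n0.
have pm m : point_moment (fun=> 1 : R^o) (empirical x : smeasure R X) m = 1.
  have := power_sum_point_moment m x (fun=> 1 : R^o) n0.
  rewrite /power_sum; under eq_bigr do rewrite expr1n.
  rewrite sumr_const card_ord -[LHS]mulr1 => /mulfI <- //.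
  by rewrite pnatr_eq0 -lt0n.
rewrite -sum_dcoef; transitivity (moment (fun=> 1 : R^o) (Ppoly k j (empirical x : smeasure R X))).
  rewrite /mass /moment /integral big_mkcond; apply: eq_bigr => t _.
  by rewrite inE big1_eq; apply: esym (mulr1 _).
rewrite moment_Ppoly; apply: eq_bigr => p _.
rewrite pm expr1n mulr1 big1 => [|q _]; last exact: pm.
exact: mulr1.
Qed.

End Plans.
End Positivity.

(** * Extreme points of the set of representable plans *)

Section Extremality.
Context {R : realType} {X : finType} (N k : nat).
Implicit Types (g : smeasure R (N.-tuple X)) (x u : N.-tuple X).

Lemma smeasure_sum_dirac {T : finType} (mu : smeasure R T) :
  mu = \sum_t (mu t : R) *: dirac t.
Proof.
apply/ffunP => a; rewrite sum_ffunE (bigD1 a) //= big1 ?addr0.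
  by rewrite !ffunE eqxx; apply: esym (mulr1 _).
by move=> t /negPf ta; rewrite !ffunE eq_sym ta; apply: mulr0.
Qed.

Lemma marginalD g h : marginal k (g + h) = marginal k g + marginal k h.
Proof.
apply/ffunP => t; rewrite [RHS]ffunE !marginalE -big_split; apply: eq_bigr => u _.
by rewrite ffunE.
Qed.

Lemma marginalZ (c : R) g : marginal k (c *: g) = c *: marginal k g.
Proof.
apply/ffunP => t; rewrite [RHS]ffunE !marginalE scaler_sumr; apply: eq_bigr => u _.
by rewrite ffunE.
Qed.

Lemma sum_symmetrize g : \sum_u symmetrize g u = \sum_u g u.
Proof.
have sumE (h : smeasure R (N.-tuple X)) : \sum_u h u = integral h (fun=> 1 : R^o).
  by apply: eq_bigr => u _; apply: esym (mulr1 _).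
by rewrite !sumE integral_symmetrize average_const.
Qed.

Lemma sum_marginal g : (k <= N)%N -> \sum_t marginal k g t = \sum_u g u.
Proof.
move=> kN; transitivity (integral (marginal k g) (fun=> 1 : R^o)).
  by apply: eq_bigr => u _; apply: esym (mulr1 _).
rewrite (integral_marginal g (fun=> 1)) //.
by apply: eq_bigr => u _; apply: mulr1.
Qed.

Lemma representable_marginal_symmetrize g : (k <= N)%N ->
  nonneg g -> \sum_u g u = 1 :> R ->
  representable N (marginal k (symmetrize g)).
Proof.
move=> kN g0 g1; split.
  apply/is_probabilityP; split; first exact/marginal_nonneg/symmetrize_nonneg.
  by rewrite sum_marginal // sum_symmetrize.
exists (symmetrize g); split=> //; last exact: symmetrize_idem.
apply/is_probabilityP; split; first exact: symmetrize_nonneg.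
by rewrite sum_symmetrize.
Qed.

Lemma dirac_nonneg (T : finType) (a : T) : nonneg (dirac a : smeasure R T).
Proof. by move=> t; rewrite ffunE ler0n. Qed.

Lemma sum_dirac (T : finType) (a : T) : \sum_t (dirac a : smeasure R T) t = 1 :> R.
Proof.
rewrite (bigD1 a) //= ffunE eqxx big1 ?addr0 // => t /negPf ta.
by rewrite ffunE ta.
Qed.

(** An atom [u] of a symmetric measure representing [mu] splits off as the multiple [g u] of
    [symmetrize (dirac u)]; extremality forces [mu] to be the marginal of that piece. *)
Lemma extreme_marginal_dirac (mu : smeasure R (k.-tuple X)) : (k <= N)%N ->
  extreme_point (representable N (k := k)) mu ->
  exists x, mu = marginal k (symmetrize (dirac x)).
Proof.
move=> kN [[_ [g [/is_probabilityP[g0 g1] gs ->]]] ext].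
have [u u0 | no_u] := pickP (fun u => g u != 0); last first.
  by move: g1; rewrite big1 => [/eqP|u _]; [rewrite eq_sym oner_eq0|apply/eqP/negPn; rewrite no_u].
exists u; have gu : 0 < (g u : R) by rewrite lt_neqAle eq_sym u0 g0.
pose t : R := g u.
pose h := g - t *: dirac u.
have hE v : h v = if v == u then 0 else g v.
  rewrite !ffunE; case: eqP => [->|_]; rewrite ?[_ *: _]mulr1 ?subrr //.
  by rewrite [_ *: _]mulr0 subr0.
have h0 : nonneg h by move=> v; rewrite hE; case: ifP.
have gE : g = t *: symmetrize (dirac u) + symmetrize h.
  by rewrite -symmetrizeZ -symmetrizeD addrC subrK gs.
have h1 : \sum_v h v = 1 - t :> R.
  rewrite -g1 (bigD1 u) //= [in RHS](bigD1 u) //= hE eqxx add0r /t addrAC subrr add0r.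
  by apply: eq_bigr => v /negPf vu; rewrite hE vu.
have rep_u : representable N (marginal k (symmetrize (dirac u : smeasure R _))).
  by apply: representable_marginal_symmetrize; rewrite ?sum_dirac //; apply: dirac_nonneg.
have t_le1 : t <= 1 by rewrite -subr_ge0 -h1 sumr_ge0.
(* If the atom carries all the mass, the remainder is zero and cannot be normalized. *)
case: (eqVneq t 1) => [t1|t1].
  have /ffunP hz : h =1 (0 : smeasure R _).
    move=> v; have /eqP := h1; rewrite [RHS]ffunE t1 subrr psumr_eq0 => [|w _]; last exact: h0.
    by move/allP/(_ v (mem_index_enum v)) => /eqP.
  by rewrite {1}gE hz symmetrize0 addr0 t1 scale1r.
have c0 : 0 < 1 - t by rewrite subr_gt0 lt_neqAle t1.
have cn0 : 1 - t != 0 by rewrite gt_eqF.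
pose h' := (1 - t)^-1 *: h.
have rep_h : representable N (marginal k (symmetrize h')).
  apply: representable_marginal_symmetrize => //.
    by move=> v; rewrite ffunE mulr_ge0 ?invr_ge0 // ltW.
  rewrite (eq_bigr (fun v => (1 - t)^-1 * h v)) => [|v _]; last by rewrite ffunE.
  by rewrite -mulr_sumr h1 mulVf.
have t01 : 0 < t < 1 by rewrite gu lt_neqAle t1.
have gC : marginal k g =
    t *: marginal k (symmetrize (dirac u)) + (1 - t) *: marginal k (symmetrize h').
  by rewrite {1}gE marginalD marginalZ symmetrizeZ marginalZ scalerA mulfV // scale1r.
by have [->] := ext _ _ t rep_u rep_h t01 gC.
Qed.

Lemma symmetrize_dirac_perm x u : perm_eq u x ->
  symmetrize (dirac u) = symmetrize (dirac x) :> smeasure R _.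
Proof.
move=> ux; apply: moment_symmetrize_inj.
by rewrite /moment !integral_dirac; apply: perm_big.
Qed.

Lemma power_sum_indicator u (a : X) m : (0 < m)%N ->
  power_sum (fun i => (tnth u i == a)%:R : R^o) m = (count_mem a u)%:R.
Proof.
move=> m0; rewrite -sum1_count big_tuple natr_sum [RHS]big_mkcond.
by apply: eq_bigr => i _ /=; case: eqP => _; rewrite ?expr1n // expr0n; case: m m0.
Qed.

(* For [v] the [k]-marginal of a symmetric [g], the quantity below is the mean under [g] of
   [(n_a - c)^2], where [n_a] counts the coordinates equal to [a]; it is linear in [v]. *)
Definition count_deviation (a : X) (c : R) (v : smeasure R (k.-tuple X)) : R :=
  let Y b : R^o := (b == a)%:R in
  (N * N.-1)%:R * integral v (fun t => \prod_(b <- take 2 t) Y b)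
  + (N%:R - 2 * c * N%:R) * integral v (fun t => \prod_(b <- take 1 t) Y b)
  + c ^+ 2 * integral v (fun=> 1 : R^o).

(** With [n] the number of coordinates equal to [a], the three integrals produce the means of
    [n (n - 1)], [(1 - 2 c) n] and [c ^ 2], which add up to that of [(n - c) ^ 2]. *)
Lemma count_deviation_marginal a c g : (2 <= k <= N)%N -> symmetrize g = g ->
  count_deviation a c (marginal k g) = \sum_u g u * ((count_mem a u)%:R - c) ^+ 2.
Proof.
move=> /andP[k2 kN] gs; have N2 := leq_trans k2 kN.
rewrite /count_deviation !integral_marginal_prod_take ?k2 ?(ltnW k2) //.
rewrite (integral_marginal g (fun=> 1 : R^o)) // /integral !mulr_sumr -!big_split.
apply: eq_bigr => u _ /=.
have f0 : N`!%:R != 0 :> R by rewrite pnatr_eq0 -lt0n fact_gt0.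
set n : R := (count_mem a u)%:R.
have := perm_sum1 (fun i => (tnth u i == a)%:R : R^o) (ltnW N2).
have := perm_sum2 (fun i => (tnth u i == a)%:R : R^o) N2.
rewrite !power_sum_indicator //; move: (perm_sum _ 1) (perm_sum _ 2) => p1 p2.
move=> /(id : _ -> (N * N.-1)%:R * (p2 : R) = N`!%:R * (n ^+ 2 - n)) e2.
move=> /(id : _ -> N%:R * (p1 : R) = N`!%:R * n) e1.
transitivity ((g u : R) * ((N`!%:R)^-1 * ((N * N.-1)%:R * (p2 : R))
    + (1 - 2 * c) * ((N`!%:R)^-1 * (N%:R * (p1 : R))) + c ^+ 2)).
  by rewrite /GRing.scale /=; ring.
by rewrite e1 e2 !mulKf //; congr (_ * _); ring.
Qed.

(** The deviations from the counts of [x] are nonnegative on representable plans and vanish at this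
    one, so they vanish at both ends of any segment having it in its interior. *)
Lemma marginal_dirac_extreme x : (2 <= k <= N)%N ->
  extreme_point (representable N (k := k))
    (marginal k (symmetrize (dirac x)) : smeasure R (k.-tuple X)).
Proof.
move=> k2N; have /andP[k2 kN] := k2N; have N2 := leq_trans k2 kN.
split.
  by apply: representable_marginal_symmetrize; rewrite ?sum_dirac //; apply: dirac_nonneg.
have L_ge0 a v : representable N v -> 0 <= count_deviation a (count_mem a x)%:R v.
  case=> _ [g [/is_probabilityP[g0 _] gs ->]]; rewrite count_deviation_marginal //.
  by apply: sumr_ge0 => u _; rewrite mulr_ge0 ?sqr_ge0.
have Lx a : count_deviation a (count_mem a x)%:R (marginal k (symmetrize (dirac x))) = 0.
  rewrite count_deviation_marginal ?symmetrize_idem //.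
  transitivity (integral (symmetrize (dirac x))
     (fun u => ((count_mem a u)%:R - (count_mem a x)%:R) ^+ 2 : R^o)); first by [].
  rewrite integral_symmetrize big1 ?scaler0 // => s _; rewrite integral_dirac.
  have /seq.permP -> := perm_permute_tuple x s.
  by rewrite subrr expr0n.
have LD a c (t : R) (v1 v2 : smeasure R (k.-tuple X)) :
    count_deviation a c (t *: v1 + (1 - t) *: v2) =
    t * count_deviation a c v1 + (1 - t) * count_deviation a c v2.
  by rewrite /count_deviation !integralD !integralZ /GRing.scale /=; ring.
have key (v1 v2 : smeasure R (k.-tuple X)) (t : R) :
    representable N v1 -> representable N v2 -> 0 < t < 1 ->
    marginal k (symmetrize (dirac x)) = t *: v1 + (1 - t) *: v2 ->
    v1 = marginal k (symmetrize (dirac x)).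
  move=> rep1 rep2 /andP[t0 t1] vE.
  have L1 a : count_deviation a (count_mem a x)%:R v1 = 0.
    have := Lx a; rewrite vE LD => /eqP.
    rewrite paddr_eq0 ?mulr_ge0 ?L_ge0 ?subr_ge0 ?ltW // mulf_eq0 gt_eqF //=.
    by case/andP=> /eqP.
  case: rep1 L1 => _ [g [/is_probabilityP[g0 g1] gs ->]] L1.
  (* The representing measure [g] itself equals [symmetrize (dirac x)]: zero deviation at every
     point confines its support to rearrangements of [x]. *)
  congr (marginal k _).
  have supp u : g u != 0 -> perm_eq u x.
    move=> gu; apply/allP => a _ /=.
    have /eqP := L1 a; rewrite count_deviation_marginal // psumr_eq0 => [|v _]; last first.
      by rewrite mulr_ge0 ?sqr_ge0.
    move/allP/(_ u (mem_index_enum u)); rewrite mulf_eq0 (negPf gu) /= sqrf_eq0 subr_eq0.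
    by rewrite eqr_nat.
  rewrite -gs [in LHS](smeasure_sum_dirac g) symmetrize_sum.
  rewrite (eq_bigr (fun u => (g u : R) *: symmetrize (dirac x))) => [|u _].
    by rewrite -scaler_suml g1 scale1r.
  rewrite symmetrizeZ; case: (eqVneq (g u) 0) => [->|/supp ux]; first by rewrite !scale0r.
  by rewrite (symmetrize_dirac_perm ux).
move=> v1 v2 t rep1 rep2 t01 vE; split; first exact: key rep1 rep2 t01 vE.
(* The other end point follows by exchanging the roles of [t] and [1 - t]. *)
apply: (key v2 v1 (1 - t)) => //; first by rewrite subr_gt0 gtrBl andbC.
by rewrite subKr addrC.
Qed.

End Extremality.

Theorem theorem4p5 (R : realType) (X : finType) (N k : nat)
    (hN : (2 <= N)%N) (hk : (2 <= k <= N)%N) :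
  [/\ (forall mu : smeasure R (k.-tuple X),
         extreme_point (representable N (k := k)) mu <->
         exists x : N.-tuple X, mu = marginal k (symmetrize (dirac x))),
      (forall x : N.-tuple X,
         let mu_k : smeasure R (k.-tuple X) :=
           marginal k (symmetrize (dirac x)) in
         let lambda : smeasure R X := marginal1 mu_k in
         [/\ lambda = N%:R^-1 *: \sum_(i < N) dirac (tnth x i),
             mu_k = Fmap N k lambda
           & forall j : nat, (1 <= j < k)%N ->
               tv_norm (Ppoly k j lambda) = mass (Ppoly k j lambda) [set: k.-tuple X]
               /\ mass (Ppoly k j lambda) [set: k.-tuple X] = (ccoef k j)%:R])
    & (forall j : nat, (1 <= j < k)%N ->
         (forall p : seq nat, is_partition j p -> (j + size p <= k)%N ->
            0 < dcoef k p :> R)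
         /\ \sum_(p <- partitions j | (j + size p <= k)%N) dcoef k p
            = (ccoef k j)%:R :> R)].
Proof.
have /andP[k2 kN] := hk; have N0 := ltnW hN.
have k0N : (0 < k <= N)%N by rewrite ltnW.
split=> [mu|x mu_k lambda|j _].
- split=> [|[x ->]]; first exact: extreme_marginal_dirac.
  exact: marginal_dirac_extreme.
- have lamE : lambda = empirical x by apply: marginal1_marginal_dirac.
  split=> [||j _]; rewrite lamE //; first exact: marginal_dirac_Fmap.
  split; last exact: mass_Ppoly_empirical.
  exact/tv_norm_nonneg/Ppoly_nonneg/empirical_nonneg.
- by split=> [p _ _|]; [apply: dcoef_gt0|apply: sum_dcoef].
Qed.
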